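(* Let $F(x)=1-e^{-\lambda x}$, $x>0$, be the distribution function of an exponential law (with $\lambda>0$), let $N$ be a random variable with values in $\{1,2,\ldots\}$ and probability generating function $Q$, and let $c\in(0,1)$. Then: (1) $F$ is $N$-max stable with constant $c$ if and only if $N$ has the Sibuya($v$) law with $v=c$, i.e. $Q(s)=1-(1-s)^v$ with $0<v<1$ and $c=v$. (2) $F$ is $N$-min stable with constant $c$ if and only if there is an integer $k>1$ such that $N$ is degenerate at $k$ (i.e. $P(N=k)=1$) and $c=1/k$.
   Context: Let $X>0$ be a random variable with continuous distribution function $F$, put $R(x)=1-F(x)$, and let $N$ be a $\{1,2,\ldots\}$-valued random variable independent of $X$ with probability generating function $Q(s)=E[s^N]$, $0\le s\le 1$. For $c\in(0,1)$: $F$ is $N$-max stable with constant $c$ if $Q[F(x)]=F(cx)$ for all $x>0$; $F$ is $N$-min stable with constant $c$ if $Q[R(cx)]=R(x)$ for all $x>0$. The Sibuya($v$) law, $0<v<1$, is the law on $\{1,2,\ldots\}$ with probability generating function $1-(1-s)^v$. *)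

(* Defs.v *)
From HB Require Import structures.
From mathcomp Require Import all_boot all_order all_algebra.
From mathcomp Require Import all_classical all_reals all_analysis.

Set Implicit Arguments.
Unset Strict Implicit.
Unset Printing Implicit Defensive.

Import Order.TTheory GRing.Theory Num.Theory.
Import numFieldNormedType.Exports.

Local Open Scope classical_set_scope.
Local Open Scope ring_scope.

(* Extended-real valued, like every library expectation; it is finite for
   0 <= s <= 1, the only range in which it is used. *)
Definition pgf (d : measure_display) (T : measurableType d) (R : realType)
    (P : probability T R) (N : {RV P >-> nat}) (s : R) : \bar R :=
  ('E_P[fun w => (s ^+ N w)%R])%E.

Definition Nmax_stable (d : measure_display) (T : measurableType d)
    (R : realType) (P : probability T R) (N : {RV P >-> nat})
    (F : R -> R) (c : R) : Prop :=
  forall x : R, 0 < x -> pgf N (F x) = (F (c * x))%:E.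

Definition Nmin_stable (d : measure_display) (T : measurableType d)
    (R : realType) (P : probability T R) (N : {RV P >-> nat})
    (F : R -> R) (c : R) : Prop :=
  let S := fun x : R => 1 - F x in
  forall x : R, 0 < x -> pgf N (S (c * x)) = (S x)%:E.

(* The power [`^] is the real power, with 0 `^ v = 0 for v != 0.  At s = 0 the
   equation reads P(N = 0) = 0, so the law is carried by the positive integers. *)
Definition sibuya_distributed (d : measure_display) (T : measurableType d)
    (R : realType) (P : probability T R) (N : {RV P >-> nat}) (v : R) : Prop :=
  0 < v < 1 /\
  forall s : R, 0 <= s <= 1 -> pgf N s = (1 - (1 - s) `^ v)%:E.

Definition degenerate_at (d : measure_display) (T : measurableType d)
    (R : realType) (P : probability T R) (N : {RV P >-> nat}) (k : nat) : Prop :=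
  P (N @^-1` [set k]) = 1%E.

Definition exponential_cdf (R : realType) (lambda x : R) : R :=
  if 0 < x then 1 - expR (- lambda * x) else 0.

Lemma exponential_cdfE (R : realType) (lambda x : R) :
  (exponential_cdf lambda x)%:E = exponential_prob lambda `]-oo, x].
Proof.
have neg0 (A : set R) : A `<=` `]-oo, 0[ -> exponential_prob lambda A = 0%E.
  move=> A0; rewrite /exponential_prob integral0_eq// => y /A0 /=.
  by rewrite in_itv/= => y0; rewrite lt0_exponential_pdf.
have split_at : forall (b : R), 0 <= b ->
    exponential_prob lambda `]-oo, b] = exponential_prob lambda `[0, b].
  move=> b b0; rewrite /exponential_prob [RHS]integral_mkcond.
  rewrite [LHS]integral_mkcond; apply: eq_integral => y _.
  rewrite !patchE !mem_setE !in_itv/=.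
  case: (leP 0 y) => //= y0; case: ifP => // _.
  by rewrite lt0_exponential_pdf.
rewrite /exponential_cdf; case: ltgtP => [x0|x0|<-].
- by rewrite split_at ?ltW// exponential_prob_itv0c.
- rewrite neg0// => y /=; rewrite !in_itv/= => yx; exact: le_lt_trans yx x0.
- rewrite split_at// /exponential_prob set_itv1 integral_set1//.
Qed.

(* Main.v *)
Require Import Defs.
From HB Require Import structures.
From mathcomp Require Import all_boot all_order all_algebra.
From mathcomp Require Import all_classical all_reals all_analysis.
From mathcomp Require Import measurable_realfun ring lra.
Import Order.TTheory GRing.Theory Num.Theory.
Import numFieldNormedType.Exports.
Local Open Scope classical_set_scope.
Local Open Scope ring_scope.

(* For the exponential law, max stability says Q(s) = 1 - (1 - s)^c after the
   substitution s = F(x), and s = 0, 1 are checked by hand. Min stability says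
   E[t^N] = t^(1/c) for 0 < t < 1. Applied to t and t^2 this gives
   E[(t^N)^2] = (E[t^N])^2, so t^N has variance zero and N is almost surely
   constant. *)

Section moments.
Context (R : realType) (d : measure_display) (T : measurableType d)
  (P : probability T R).

(** The variance is [m ^+ 2 - 2 * m * m + m ^+ 2 = 0], and a nonnegative function with integral zero
    vanishes almost everywhere. *)
Lemma ae_eq_cst_of_moments (X : T -> R) (m : R) :
    X \in Lfun P 1 -> X ^+ 2 \in Lfun P 1 ->
    'E_P[X]%E = m%:E -> 'E_P[X ^+ 2]%E = (m ^+ 2)%:E ->
  {ae P, forall w, X w = m}.
Proof.
move=> X1 X21 EX EX2.
have mX : measurable_fun [set: T] X.
  by move/Lfun1_integrable: X1 => /measurable_int/measurable_EFinP.
have mY : measurable_fun [set: T] (EFin \o (fun w => (X w - m) ^+ 2)).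
  by apply/measurable_EFinP; apply: measurable_funX; apply: measurable_funB.
have LZ : (2 * m) \o* X \in Lfun P 1 by exact: Lfun_scale.
have Lc : cst (m ^+ 2) \in Lfun P 1 by exact: Lfun_cst.
have LZc : (2 * m) \o* X \- cst (m ^+ 2) \in Lfun P 1 by exact: rpredB.
have EY : (\int[P]_w `|((X w - m) ^+ 2)%:E| = 0)%E.
  under eq_integral do rewrite gee0_abs ?lee_fin ?sqr_ge0//.
  (* The square is expanded into integrable pieces, so that linearity of the expectation applies. *)
  transitivity ('E_P[(X ^+ 2 \- ((2 * m) \o* X \- cst (m ^+ 2)))%R]%E).
    rewrite expectation.unlock; apply: eq_integral => w _; congr EFin.
    by rewrite /= -[(X ^+ 2) w]/(X w * X w); ring.
  rewrite (expectationB X21 LZc) (expectationB LZ Lc).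
  rewrite (expectationZl _ X1) expectation_cst EX EX2.
  by rewrite -EFinM -!EFinB; congr EFin; ring.
have := (ae_eq_integral_abs P measurableT mY).1 EY.
apply: filterS => w /(_ I) /= [] /eqP.
by rewrite sqrf_eq0 subr_eq0 => /eqP.
Qed.

End moments.

Section pgf.
Context (R : realType) (d : measure_display) (T : measurableType d)
  (P : probability T R) (N : {RV P >-> nat}).

Lemma measurable_expr_rv (s : R) : measurable_fun [set: T] (fun w => s ^+ N w).
Proof.
have mf : measurable_fun [set: nat] (fun n : nat => s ^+ n) by [].
exact: measurableT_comp mf (measurable_funPT N).
Qed.

Lemma Lfun1_expr_rv (s : R) : 0 <= s <= 1 -> (fun w => s ^+ N w) \in Lfun P 1.
Proof.
move=> /andP[s0 s1]; apply/Lfun1_integrable; apply: measurable_bounded_integrable => //.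
- by rewrite -ge0_fin_numE// fin_num_measure.
- exact: measurable_expr_rv.
- exists 1; split => // M M1 w _ /=.
  by rewrite ger0_norm ?exprn_ge0// (le_trans _ (ltW M1))// exprn_ile1.
Qed.

Lemma pgf1 : pgf N 1 = 1%:E.
Proof.
rewrite /pgf -(expectation_cst P 1); congr expectation.
by apply/funext => w; rewrite expr1n.
Qed.

(** Positivity of [N] excludes the value [0 ^+ 0 = 1]. *)
Lemma pgf0 : (forall w, (0 < N w)%N) -> pgf N 0 = 0%:E.
Proof.
move=> N0; rewrite /pgf -(expectation_cst P 0); congr expectation.
by apply/funext => w; rewrite expr0n eqn0Ngt N0.
Qed.

Lemma ae_rv_of_degenerate (k : nat) :
  degenerate_at N k -> {ae P, forall w, N w = k}.
Proof.
rewrite /degenerate_at => Nk; have mA : measurable (N @^-1` [set k]).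
  by rewrite -[X in measurable X]setTI; exact: measurable_funPT.
apply/negligibleP; first exact: measurableC.
by rewrite [LHS](probability_setC P mA) Nk subee.
Qed.

Lemma degenerate_of_ae_rv (k : nat) :
  {ae P, forall w, N w = k} -> degenerate_at N k.
Proof.
have mA : measurable (N @^-1` [set k]).
  by rewrite -[X in measurable X]setTI; exact: measurable_funPT.
move=> /negligibleP NA; have {}NA := NA (measurableC mA).
rewrite /degenerate_at -[N @^-1` _]setCK.
by rewrite (probability_setC P (measurableC mA)) [X in (_ - X)%E]NA sube0.
Qed.

Lemma pgf_degenerate (k : nat) (s : R) :
  degenerate_at N k -> pgf N s = (s ^+ k)%:E.
Proof.
move=> /ae_rv_of_degenerate Nk; rewrite -(expectation_cst P (s ^+ k)) /pgf expectation.unlock.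
apply: ae_eq_integral => //.
- by apply/measurable_EFinP; exact: measurable_expr_rv.
- by apply/measurable_EFinP; exact: measurable_cst.
- by apply: filterS Nk => w -> _.
Qed.

(** Since [(t ^+ N) ^+ 2 = (t ^+ 2) ^+ N], the generating function at [t] and [t ^+ 2] gives the
    first two moments of the bounded variable [t ^+ N]. *)
Lemma ae_expr_rv_of_pgf (t m : R) : 0 <= t <= 1 ->
    pgf N t = m%:E -> pgf N (t ^+ 2) = (m ^+ 2)%:E ->
  {ae P, forall w, t ^+ N w = m}.
Proof.
move=> t01 Qt Qt2.
have sqE : (fun w => t ^+ N w) ^+ 2 = (fun w => (t ^+ 2) ^+ N w).
  by apply/funext => w; rewrite -exprM mulnC exprM.
have t201 : 0 <= t ^+ 2 <= 1.
  by case/andP: t01 => t0 t1; rewrite sqr_ge0 exprn_ile1.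
apply: ae_eq_cst_of_moments => //; rewrite ?sqE//; exact: Lfun1_expr_rv.
Qed.

End pgf.

Section exponential.
Context (R : realType) (d : measure_display) (T : measurableType d)
  (P : probability T R) (N : {RV P >-> nat}) (lambda c : R).
Hypotheses (lambda0 : 0 < lambda) (c01 : 0 < c < 1).

Let c0 : 0 < c. Proof. by case/andP: c01. Qed.

Lemma exponential_cdf_gt0E (x : R) :
  0 < x -> exponential_cdf lambda x = 1 - expR (- lambda * x).
Proof. by rewrite /exponential_cdf => ->. Qed.

Lemma Nmax_stable_exponentialP :
  Nmax_stable N (exponential_cdf lambda) c <->
  forall s : R, 0 < s < 1 -> pgf N s = (1 - (1 - s) `^ c)%:E.
Proof.
split=> [H s /andP[s0 s1]|H x x0].
(* This is the quantile at [s], the solution of [F(x) = s]. *)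
- pose x := - ln (1 - s) / lambda.
  have x0 : 0 < x by rewrite divr_gt0// oppr_gt0 ln_lt0//; lra.
  have e : expR (- lambda * x) = 1 - s.
    have -> : - lambda * x = ln (1 - s) by rewrite /x; field; exact: lt0r_neq0.
    by rewrite lnK// posrE; lra.
  clearbody x; have := H x x0; rewrite !exponential_cdf_gt0E ?mulr_gt0//.
  by rewrite (mulrC c) mulrA e expRM e subKr.
- have e1 : expR (- lambda * x) < 1 by rewrite expR_lt1 mulNr oppr_lt0 mulr_gt0.
  have e0 := expR_gt0 (- lambda * x).
  rewrite !exponential_cdf_gt0E ?mulr_gt0// H; last by lra.
  by rewrite (mulrC c) mulrA (expRM (- lambda * x)) subKr.
Qed.

Lemma Nmin_stable_exponentialP :
  Nmin_stable N (exponential_cdf lambda) c <->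
  forall t : R, 0 < t < 1 -> pgf N t = (t `^ c^-1)%:E.
Proof.
have cN0 : c != 0 by exact: lt0r_neq0.
split=> [H t /andP[t0 t1]|H S x x0].
- pose x := - ln t / lambda / c.
  have x0 : 0 < x by rewrite !divr_gt0// oppr_gt0 ln_lt0// t0.
  have e : expR (- lambda * (c * x)) = t.
    have -> : - lambda * (c * x) = ln t.
      by rewrite /x; field; rewrite cN0 lt0r_neq0.
    by rewrite lnK.
  clearbody x; have := H x x0; rewrite /= !exponential_cdf_gt0E ?mulr_gt0// !subKr e => ->.
  by rewrite -e -expRM; congr (expR _)%:E; field.
- rewrite /S !exponential_cdf_gt0E ?mulr_gt0// !subKr H.
    by rewrite -expRM; congr (expR _)%:E; field.
  by rewrite expR_gt0 expR_lt1 mulNr oppr_lt0 !mulr_gt0.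
Qed.

Lemma Nmax_stable_exponential_sibuya : (forall w, (0 < N w)%N) ->
  Nmax_stable N (exponential_cdf lambda) c <-> sibuya_distributed N c.
Proof.
move=> N0; rewrite Nmax_stable_exponentialP; split=> [H|[_ H] s /andP[s0 s1]].
- split=> // s /andP[].
  rewrite le_eqVlt => /predU1P[<- _|s0].
    by rewrite pgf0// subr0 powR1 subrr.
  rewrite le_eqVlt => /predU1P[->|s1]; last by rewrite H ?s0.
  by rewrite pgf1 subrr powR0 ?subr0// lt0r_neq0.
- by apply: H; rewrite !ltW.
Qed.

Lemma Nmin_stable_exponential_degenerate :
  Nmin_stable N (exponential_cdf lambda) c <->
  exists k : nat, [/\ (1 < k)%N, degenerate_at N k & c = k%:R^-1].
Proof.
rewrite Nmin_stable_exponentialP; split=> [H|[k [k1 Nk ->]] t /andP[t0 t1]]; last first.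
  by rewrite invrK powR_mulrn ?ltW//; exact: pgf_degenerate.
(* A single [t] suffices, because the powers of [t] are pairwise distinct. *)
have [t t0 t1] : exists2 t : R, 0 < t & t < 1 by exists 2^-1; lra.
have tN : {ae P, forall w, t ^+ N w = t `^ c^-1}.
  apply: ae_expr_rv_of_pgf; rewrite ?ltW//; first by apply: H; rewrite t0.
  (* The second moment is the square of the first: [(t ^+ 2)]^ c^-1 = (t [^ c^-1) ^+ 2]. *)
  rewrite H; last by rewrite exprn_gt0//= exprn_ilt1 ?ltW.
  by rewrite -(powR_mulrn 2 (ltW t0)) -(powR_mulrn 2 (powR_ge0 _ _)) -!powRrM mulrC.
(* An almost sure event of a probability space is nonempty; the value of [N] at such a point serves
   as [k]. *)
have [w0 w0E] : exists w, t ^+ N w = t `^ c^-1.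
  have : ProperFilter (almost_everywhere P).
    by apply: ae_properfilter_algebraOfSetsType; rewrite [ltRHS](probability_setT P).
  by move=> ?; exact: filter_ex tN.
(* Taking logarithms, both sides are multiples of [ln t], which is nonzero. *)
have cE : (N w0)%:R = c^-1.
  have lnt0 : ln t != 0 by rewrite lt_eqF// ln_lt0// t0.
  by apply: (mulIf lnt0); rewrite -!ln_powR -w0E powR_mulrn// ltW.
exists (N w0); split.
- by rewrite -(ltr_nat R) cE invf_gt1//; case/andP: c01.
- apply: degenerate_of_ae_rv; apply: filterS tN => w.
  by rewrite -w0E; apply: ieexprIn => //; rewrite lt_eqF.
- by rewrite cE invrK.
Qed.

End exponential.

Theorem mainTheorem1 (R : realType) (d : measure_display)
    (T : measurableType d) (P : probability T R) (N : {RV P >-> nat})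
    (lambda c : R) (hN : forall w : T, (0 < N w)%N)
    (hlambda : 0 < lambda) (hc : 0 < c < 1) :
  (Nmax_stable N (exponential_cdf lambda) c <->
    exists v : R, sibuya_distributed N v /\ c = v) /\
  (Nmin_stable N (exponential_cdf lambda) c <->
    exists k : nat, [/\ (1 < k)%N, degenerate_at N k & c = k%:R^-1]).
Proof.
split; last exact: Nmin_stable_exponential_degenerate.
rewrite Nmax_stable_exponential_sibuya//.
by split=> [H|[v [H ->]]//]; exists c.
Qed.
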